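(* Let $\mathcal{H}$ be a separable Hilbert space and $I$ a countable index set. Let $W=\{(W_i,\omega_i)\}_{i\in I}$ be a fusion frame for $\mathcal{H}$ and let $V=\{(V_i,\omega_i)\}_{i\in I}$ be a dual fusion frame of $W$ such that $\{W_i\}_{i\in\sigma}\cup\{V_i\}_{i\in\sigma^c}$ is a fusion frame sequence for all $\sigma\subset I$. Then $W$ and $V$ are woven.
   Context: $\pi_V$ is the orthogonal projection onto a closed subspace $V$; $\sigma^c=I\setminus\sigma$. A family $\{(W_i,\omega_i)\}_{i\in I}$ of closed subspaces and weights $\omega_i>0$ is a fusion frame for $\mathcal{H}$ with bounds $C,D$ if $0<C\le D<\infty$ and $C\|f\|^2\le\sum_{i\in I}\omega_i^2\|\pi_{W_i}f\|^2\le D\|f\|^2$ for all $f\in\mathcal{H}$; it is a Bessel fusion sequence if the upper inequality holds for some $D<\infty$. It is a fusion frame sequence if it is a fusion frame for $\overline{\operatorname{span}}\{W_i\}_{i\in I}$. When a family of subspaces is written without weights, all weights are understood to equal $1$. The fusion frame operator is $S_Wf=\sum_{i\in I}\omega_i^2\pi_{W_i}f$, which is bounded, positive and invertible for a fusion frame. A Bessel fusion sequence $\{(V_i,\nu_i)\}_{i\in I}$ is a dual fusion frame of a fusion frame $W=\{(W_i,\omega_i)\}_{i\in I}$ if $f=\sum_{i\in I}\omega_i\nu_i\pi_{V_i}S_W^{-1}\pi_{W_i}f$ for all $f\in\mathcal{H}$. Two fusion frames $\{(W_i,\omega_i)\}_{i\in I}$ and $\{(V_i,\nu_i)\}_{i\in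 I}$ are woven if there are universal constants $0<C\le D<\infty$ such that for every $\sigma\subset I$ the family $\{(W_i,\omega_i)\}_{i\in\sigma}\cup\{(V_i,\nu_i)\}_{i\in\sigma^c}$ is a fusion frame for $\mathcal{H}$ with bounds $C,D$. *)

(* Defs.v *)
From HB Require Import structures.
From mathcomp Require Import all_boot all_order all_algebra.
From mathcomp Require Import sesquilinear complex.
From mathcomp Require Import all_classical all_reals all_analysis.
From mathcomp Require summability.

Set Implicit Arguments.
Unset Strict Implicit.
Unset Printing Implicit Defensive.

Import Order.TTheory GRing.Theory Num.Theory.
Import numFieldNormedType.Exports.

Local Open Scope classical_set_scope.
Local Open Scope ring_scope.

(* Hilbert spaces are over the reals R or over the complex numbers R[i]. *)
Variant scalars := RealScalars | ComplexScalars.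

Definition scalar_field (R : realType) (k : scalars) : numFieldType :=
  match k with RealScalars => R | ComplexScalars => R[i] end.

Definition scalar_conj (R : realType) (k : scalars) :
    involutive_rmorphism (scalar_field R k) :=
  match k with
  | RealScalars => @idfun R : involutive_rmorphism R
  | ComplexScalars => @Num.conj R[i] : involutive_rmorphism R[i]
  end.

Definition scalar_re (R : realType) (k : scalars) : scalar_field R k -> R :=
  match k with RealScalars => id | ComplexScalars => @complex.Re R end.

Definition scalar_of (R : realType) (k : scalars) : R -> scalar_field R k :=
  match k with RealScalars => id | ComplexScalars => real_complex R end.

HB.mixin Record isHilbert (R : realType) (k : scalars) H
    of CompleteNormedModule (scalar_field R k) H := {
  inner : {dot H for scalar_conj R k} ;
  inner_norm : forall f : H, inner f f = `|f| ^+ 2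
}.

#[short(type="hilbertType")]
HB.structure Definition Hilbert (R : realType) (k : scalars) :=
  {H of CompleteNormedModule (scalar_field R k) H & isHilbert R k H}.

Definition separable (T : topologicalType) :=
  exists2 S : set T, countable S & dense S.

Section FusionFrames.
Context {R : realType} {k : scalars} {H : hilbertType R k}.

(* The norm of H takes its values in the scalar field; hnorm is the same
   number seen in R. *)
Definition hnorm (f : H) : R := scalar_re `|f|.

Definition closed_subspace (V : set H) := submod_closed [in V] /\ closed V.

Definition closed_span (A : set H) : set H :=
  closure (smallest [set V : set H | submod_closed [in V]] A).

(* The value is unique, and it exists when V is a closed subspace. *)
Definition proj (V : set H) (f : H) : H :=
  xget 0 [set p | V p /\ forall v, V v -> inner (f - p) v = 0].

Context {I : countType}.
Implicit Types (W V : I -> set H) (w v : I -> R).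

Definition frame_sum W w (f : H) : \bar R :=
  \esum_(i in [set: I]) (w i ^+ 2 * hnorm (proj (W i) f) ^+ 2)%:E.

(* Fusion frame for the closed subspace K of H: as each W i lies in K, the
   orthogonal projection of K onto W i is the restriction of that of H. *)
Definition fusion_frame_with (K : set H) W w (C D : R) :=
  [/\ forall i, [/\ closed_subspace (W i), W i `<=` K & 0 < w i],
      0 < C, C <= D
    & forall f, K f ->
        ((C * hnorm f ^+ 2)%:E <= frame_sum W w f)%E /\
        (frame_sum W w f <= (D * hnorm f ^+ 2)%:E)%E].

Definition fusion_frame (K : set H) W w :=
  exists C D : R, fusion_frame_with K W w C D.

Definition bessel_fusion_sequence W w :=
  (forall i, closed_subspace (W i) /\ 0 < w i) /\
  exists D : R, forall f, (frame_sum W w f <= (D * hnorm f ^+ 2)%:E)%E.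

Definition fusion_frame_sequence W w :=
  fusion_frame (closed_span (\bigcup_i W i)) W w.

(* Vector-valued series over I are limits along the finite subsets of I. *)
Definition fusion_frame_operator W w (f : H) : H :=
  summability.sum (fun i => scalar_of k (w i ^+ 2) *: proj (W i) f).

Definition fusion_frame_operator_inv W w : H -> H :=
  'pinv_(fun=> 0) [set: H] (fusion_frame_operator W w).

Definition dual_fusion_frame V v W w :=
  bessel_fusion_sequence V v /\
  forall f, summability.partial_sum (fun i =>
      scalar_of k (w i * v i) *:
        proj (V i) (fusion_frame_operator_inv W w (proj (W i) f)))
    @ summability.totally --> f.

(* patch V s W takes W i for i in s and V i otherwise. *)
Definition woven W w V v :=
  [/\ fusion_frame [set: H] W w, fusion_frame [set: H] V v
    & exists C D : R, forall s : set I,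
        fusion_frame_with [set: H] (patch V s W) (patch v s w) C D].

End FusionFrames.

(* Main.v *)
Require Import Defs.
From mathcomp Require Import all_boot all_order all_algebra.
From mathcomp Require Import finmap sesquilinear complex ring lra.
From mathcomp Require Import all_classical all_reals all_analysis.
From mathcomp Require summability.

Set Implicit Arguments.
Unset Strict Implicit.
Unset Printing Implicit Defensive.

Import Order.TTheory GRing.Theory Num.Theory.
Import numFieldNormedType.Exports.
Import Defs.

Local Open Scope classical_set_scope.
Local Open Scope ring_scope.

(* For each index set s the duality formula writes |f|^2 as the sum over i of
   w_i^2 <S^-1 pi_{W_i} f, pi_{V_i} f>, and the norm of S^-1 is at most 1/C,
   where C is the lower frame bound of W.  By Cauchy-Schwarz and AM-GM the i-th
   term is controlled by the norm of the projection used by the woven family at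
   i (with a large constant) and the norm of the other one (with a small
   constant); the latter sum up to a fraction of |f|^2, by the Bessel bounds DW
   and DV, and are absorbed.  This gives the lower bound C^2 / (DW + DV) for
   every s at once, and DW + DV is an upper bound. *)

(** * Real parts and real scalars, for both scalar fields at once *)

Section Scalars.
Context {R : realType} {k : scalars}.
Implicit Types (x y : scalar_field R k) (a b : R).

Lemma scalar_reD x y : scalar_re (x + y) = scalar_re x + scalar_re y.
Proof. by case: k x y => //= -[? ?] [? ?]. Qed.

Lemma scalar_reN x : scalar_re (- x) = - scalar_re x.
Proof. by case: k x => //= -[? ?]. Qed.

Lemma scalar_re_conj x : scalar_re (scalar_conj R k x) = scalar_re x.
Proof. by case: k x => //= -[? ?]. Qed.

Lemma scalar_reZ a x : scalar_re (scalar_of k a * x) = a * scalar_re x.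
Proof. by case: k x => //= -[? ?] /=; rewrite mul0r subr0. Qed.

Lemma scalar_reK x : 0 <= x -> scalar_of k (scalar_re x) = x.
Proof. by case: k x => //= x /ger0_Im; case: x => a b /= ->. Qed.

Lemma scalar_re_ge0 x : 0 <= x -> 0 <= scalar_re x.
Proof. by case: k x => //= x; rewrite lecE => /andP[]. Qed.

Lemma scalar_of_lt a b : (scalar_of k a < scalar_of k b) = (a < b).
Proof. by case: k => //=; rewrite ltcR. Qed.

Lemma scalar_of0 : scalar_of k 0 = 0 :> scalar_field R k.
Proof. by case: k. Qed.

Lemma scalar_ofM a b : scalar_of k (a * b) = scalar_of k a * scalar_of k b.
Proof. by case: k => //=; rewrite rmorphM. Qed.

Lemma scalar_of_norm a : `|scalar_of k a| = scalar_of k `|a|.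
Proof. by case: k => //=; rewrite normc_def /= expr0n addr0 sqrtr_sqr. Qed.

Lemma scalar_ofK a : scalar_re (scalar_of k a) = a.
Proof. by case: k. Qed.

(** Used to pass from vanishing real parts to true orthogonality. *)
Lemma scalar_re_conj_mul_eq0 x : scalar_re (scalar_conj R k x * x) = 0 -> x = 0.
Proof.
case: k x => /= [x /eqP|[a b] /= ab0]; first by rewrite mulf_eq0 orbb => /eqP.
by have [-> ->] : a = 0 /\ b = 0 by split; nra.
Qed.

End Scalars.

(** * The underlying real inner product and its inequalities *)

Section HilbertGeometry.
Context {R : realType} {k : scalars} {H : hilbertType R k}.
Implicit Types (f g u v : H) (a : R).

(** The real part of the inner product is a real inner product with the same norm, so all estimates
    can be made in [R] for both kinds of scalars. *)
Definition rdot f g : R := scalar_re (inner f g).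

Lemma rdotC f g : rdot f g = rdot g f.
Proof. by rewrite /rdot hermC /= expr0 mul1r scalar_re_conj. Qed.

Lemma rdotDl f g u : rdot (f + g) u = rdot f u + rdot g u.
Proof. by rewrite /rdot linearDl scalar_reD. Qed.

Lemma rdotNl f u : rdot (- f) u = - rdot f u.
Proof. by rewrite /rdot linearNl scalar_reN. Qed.

Lemma rdotZl a f u : rdot (scalar_of k a *: f) u = a * rdot f u.
Proof. by rewrite /rdot linearZl_LR scalar_reZ. Qed.

Lemma rdotDr f g u : rdot u (f + g) = rdot u f + rdot u g.
Proof. by rewrite rdotC rdotDl !(rdotC u). Qed.

Lemma rdotNr f u : rdot u (- f) = - rdot u f.
Proof. by rewrite rdotC rdotNl (rdotC u). Qed.

Lemma rdotZr a f u : rdot u (scalar_of k a *: f) = a * rdot u f.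
Proof. by rewrite rdotC rdotZl (rdotC u). Qed.

Lemma rdot0l u : rdot 0 u = 0.
Proof. by rewrite -[X in rdot X _](subrr u) rdotDl rdotNl subrr. Qed.

Lemma rdot_suml (T : Type) (r : seq T) (F : T -> H) u :
  rdot (\sum_(i <- r) F i) u = \sum_(i <- r) rdot (F i) u.
Proof.
elim: r => [|x r IH]; first by rewrite !big_nil rdot0l.
by rewrite !big_cons rdotDl IH.
Qed.

Lemma norm_hnorm f : `|f| = scalar_of k (hnorm f).
Proof. by rewrite scalar_reK. Qed.

Lemma hnorm_ge0 f : 0 <= hnorm f.
Proof. exact: scalar_re_ge0. Qed.

Lemma rdotff f : rdot f f = hnorm f ^+ 2.
Proof.
by rewrite /rdot inner_norm norm_hnorm !expr2 -scalar_ofM scalar_ofK.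
Qed.

Lemma hnorm_eq0 f : hnorm f = 0 -> f = 0.
Proof. by move=> f0; apply/eqP; rewrite -normr_eq0 norm_hnorm f0 scalar_of0. Qed.

Lemma hnormZ a f : hnorm (scalar_of k a *: f) = `|a| * hnorm f.
Proof. by rewrite /hnorm normrZ scalar_of_norm scalar_reZ. Qed.

Lemma hnorm_opp f : hnorm (- f) = hnorm f.
Proof. by rewrite /hnorm normrN. Qed.

Lemma hnorm_sqrD f g :
  hnorm (f + g) ^+ 2 = hnorm f ^+ 2 + 2 * rdot f g + hnorm g ^+ 2.
Proof. by rewrite -!rdotff !(rdotDl, rdotDr) (rdotC g f); ring. Qed.

Lemma hnorm_sqrB f g :
  hnorm (f - g) ^+ 2 = hnorm f ^+ 2 - 2 * rdot f g + hnorm g ^+ 2.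
Proof. by rewrite hnorm_sqrD rdotNr hnorm_opp mulrN. Qed.

(** Cauchy-Schwarz: expand the square of | |g| f - |f| g | and divide by |f| |g|. *)
Lemma rdot_le f g : rdot f g <= hnorm f * hnorm g.
Proof.
have [/hnorm_eq0 ->|f0] := eqVneq (hnorm f) 0.
  by rewrite rdot0l mulr_ge0 // hnorm_ge0.
have [/hnorm_eq0 ->|g0] := eqVneq (hnorm g) 0.
  by rewrite rdotC rdot0l mulr_ge0 // hnorm_ge0.
have {}f0 : 0 < hnorm f by rewrite lt_def f0 hnorm_ge0.
have {}g0 : 0 < hnorm g by rewrite lt_def g0 hnorm_ge0.
have := sqr_ge0 (hnorm (scalar_of k (hnorm g) *: f - scalar_of k (hnorm f) *: g)).
rewrite hnorm_sqrB rdotZl rdotZr !hnormZ !ger0_norm ?hnorm_ge0 // => h.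
have {}h : hnorm f * hnorm g * rdot f g <= (hnorm f * hnorm g) * (hnorm f * hnorm g).
  by lra.
by rewrite ler_pM2l ?mulr_gt0 in h.
Qed.

Lemma hnorm_triangle f g : hnorm (f + g) <= hnorm f + hnorm g.
Proof.
rewrite -(@ler_pXn2r _ 2) ?nnegrE ?addr_ge0 ?hnorm_ge0 //.
by rewrite hnorm_sqrD; have := rdot_le f g; lra.
Qed.

End HilbertGeometry.

(** * Nearest points and orthogonal projections *)

Section HilbertTopology.
Context {R : realType} {k : scalars} {H : hilbertType R k}.
Implicit Types (f g u v p : H) (F : set_system H) (V : set H) (e : R).

Lemma cvg_hnorm_lt F p e : Filter F -> F --> p -> 0 < e ->
  F [set g | hnorm (p - g) < e].
Proof.
move=> FF /fcvgrPdist_lt Fp e0.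
have : 0 < scalar_of k e by rewrite -(scalar_of0 (k := k)) scalar_of_lt.
by move=> /Fp; apply: filterS => g /=; rewrite norm_hnorm scalar_of_lt.
Qed.

Lemma hnorm_cauchy_cvg F : ProperFilter F ->
  (forall e, 0 < e -> exists g, F [set h | hnorm (g - h) < e]) -> cvg F.
Proof.
move=> FF Fc; apply: cauchy_cvg; apply: cauchy_exP => eps eps0.
have epsE := scalar_reK (ltW eps0).
have [|g Fg] := Fc (scalar_re eps).
  by rewrite -(scalar_of_lt (k := k)) epsE scalar_of0.
exists g; apply: filterS Fg => h /=.
by rewrite -ball_normE /= norm_hnorm -{2}epsE scalar_of_lt.
Qed.

Lemma closed_subspace_lin V : closed_subspace V ->
  forall (c : scalar_field R k) u v, V u -> V v -> V (c *: u + v).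
Proof.
by move=> [[_ Vlin] _] c u v Vu Vv; apply/set_mem/Vlin; exact/mem_set.
Qed.

Lemma closed_subspace0 V : closed_subspace V -> V 0.
Proof. by move=> [[V0 _] _]; exact/set_mem. Qed.

(* The subsets of V that nearly minimize the distance to f are the base of a
   Cauchy filter, by the parallelogram law. *)
Lemma nearest_point V f : closed_subspace V ->
  exists2 p, V p & forall v, V v -> hnorm (f - p) <= hnorm (f - v).
Proof.
move=> Vc; pose D := [set hnorm (f - v) ^+ 2 | v in V]; pose d := inf D.
have lbD : has_lbound D by exists 0 => _ [v _ <-]; exact: sqr_ge0.
have dP v : V v -> d <= hnorm (f - v) ^+ 2.
  by move=> Vv; apply: ge_inf => //; exists v.
pose B e := [set v | V v /\ hnorm (f - v) ^+ 2 < d + e].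
pose F := filter_from [set e | 0 < e] B.
have B_mono (e1 e2 : R) : e1 <= e2 -> B e1 `<=` B e2.
  by move=> e12 v [Vv ve1]; split=> //; apply: lt_le_trans ve1 _; rewrite lerD2l.
have FF : ProperFilter F.
  apply: filter_from_proper => [|e e0].
    apply: filter_from_filter => [|e1 e2 e10 e20]; first by exists 1 => /=.
    exists (Num.min e1 e2); first by rewrite /= lt_min e10.
    by rewrite subsetI; split; apply: B_mono; rewrite ge_min lexx ?orbT.
  have [|_ [v Vv <-] vd] := @inf_adherent _ D e e0; last by exists v.
  by split=> //; exists (hnorm (f - 0) ^+ 2), 0 => //; exact: closed_subspace0.
have /hnorm_cauchy_cvg : forall e, 0 < e -> exists g, F [set h | hnorm (g - h) < e].
  (* For g and h in [B] (e^2 / 4) the midpoint lies in [V], so its squared distance to f is at least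
     d; the parallelogram law then gives |g - h|^2 < 4 (d + e^2 / 4) - 4 d = e^2. *)
  move=> e e0; have e20 : 0 < e ^+ 2 / 4 by rewrite divr_gt0 ?exprn_gt0.
  have /filter_ex[g Bg] : F (B (e ^+ 2 / 4)) by exists (e ^+ 2 / 4).
  exists g, (e ^+ 2 / 4) => // h Bh /=.
  rewrite -(@ltr_pXn2r _ 2) ?nnegrE ?hnorm_ge0 ?(ltW e0) //.
  have Vgh : V (scalar_of k 2^-1 *: g + (scalar_of k 2^-1 *: h + 0)).
    do 2?[apply: closed_subspace_lin => //]; [exact: Bg.1|exact: Bh.1|].
    exact: closed_subspace0.
  have := dP _ Vgh; have := Bg.2; have := Bh.2.
  rewrite !addr0 -!rdotff !(rdotDl, rdotDr, rdotNl, rdotNr, rdotZl, rdotZr).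
  rewrite (rdotC g f) (rdotC h f) (rdotC h g).
  lra.
move=> Fcvg; exists (lim F) => [|v Vv].
  apply: Vc.2 => A /Fcvg[e /= e0 BA].
  by have /filter_ex[g Bg] : F (B e) by [exists e]; exists g; split; [exact: Bg.1|exact: BA].
apply/ler_addgt0Pr => e e0.
(* The slack (e / 2)^2 on squared distances costs at most e / 2 on distances, and g is within e / 2
   of the limit. *)
have /filter_ex[g [/= gF [Vg gd]]] : F ([set g | hnorm (lim F - g) < e / 2] `&` B ((e/2) ^+ 2)).
  apply: filterI; first by apply: cvg_hnorm_lt; rewrite ?divr_gt0.
  by exists ((e / 2) ^+ 2) => //=; rewrite exprn_gt0 ?divr_gt0.
have gv : hnorm (f - g) <= hnorm (f - v) + e / 2.
  rewrite -(@ler_pXn2r _ 2) ?nnegrE ?addr_ge0 ?hnorm_ge0 ?divr_ge0 ?(ltW e0) //.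
  have := dP _ Vv; have := hnorm_ge0 (f - v); nra.
have := hnorm_triangle (f - g) (g - lim F).
by rewrite addrA subrK -(hnorm_opp (g - lim F)) opprB; lra.
Qed.

(** The nearest point p satisfies the condition that defines [proj]: no move from p inside [V]
    shortens the distance to f. *)
Lemma proj_spec V f : closed_subspace V ->
  V (proj V f) /\ forall v, V v -> inner (f - proj V f) v = 0.
Proof.
move=> Vc; rewrite /proj; apply: (@xgetPex _ 0 [set p | V p /\ _]).
have [p Vp pmin] := nearest_point f Vc; exists p; split=> //.
have rdot0 v : V v -> rdot (f - p) v = 0.
  (* The optimal move along v has length c / |v|^2; adding 1 to the denominator covers v = 0.
     Minimality at p + t v then yields t^2 (|v|^2 + 2) <= 0, hence t = 0 and c = 0. *)
  move=> Vv; set c := rdot _ _; set t := c / (hnorm v ^+ 2 + 1).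
  have n0 := sqr_ge0 (hnorm v).
  have ct : c = t * (hnorm v ^+ 2 + 1) by rewrite divfK // gt_eqF //; lra.
  have := pmin _ (closed_subspace_lin Vc (scalar_of k t) Vv Vp).
  rewrite -(@ler_pXn2r _ 2) ?nnegrE ?hnorm_ge0 // opprD addrCA [- _ + (f - p)]addrC.
  rewrite (hnorm_sqrB (f - p)) rdotZr hnormZ exprMn real_normK ?num_real // -/c.
  rewrite ct => h; have /eqP : t ^+ 2 = 0.
    by have := sqr_ge0 t; have := mulr_ge0 (sqr_ge0 t) n0; lra.
  by rewrite sqrf_eq0 => /eqP ->; rewrite mul0r.
(* Testing against the multiple <f - p, v> v turns the real part into a squared modulus. *)
move=> v Vv; apply: scalar_re_conj_mul_eq0.
have := rdot0 _ (closed_subspace_lin Vc (inner (f - p) v) Vv (closed_subspace0 Vc)).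
by rewrite addr0 /rdot linearZr_LR.
Qed.

(** The difference g - [proj V g] is orthogonal to [V]. Applied twice, this gives self-adjointness
    of the projection. *)
Lemma rdot_proj V f g : closed_subspace V ->
  rdot (proj V f) g = rdot (proj V f) (proj V g).
Proof.
move=> Vc; have [[Vf _] [_ Vg]] := (proj_spec f Vc, proj_spec g Vc).
apply/eqP; rewrite -subr_eq0 -rdotNr -rdotDr rdotC /rdot Vg //.
by case: (k).
Qed.

End HilbertTopology.

(** Dividing by z + 1 instead of z allows z = 0. *)
Lemma ler_eps (R : realFieldType) (x y z : R) : 0 <= z ->
  (forall e, 0 < e -> x <= y + e * z) -> x <= y.
Proof.
move=> z0 xy; apply/ler_addgt0Pr => e e0.
have z1 : 0 < z + 1 by rewrite ltr_wpDl.
apply: le_trans (xy (e / (z + 1)) _) _; first by rewrite divr_gt0.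
by rewrite lerD2l -mulrA ler_piMr ?(ltW e0) // mulrC ler_pdivrMr // mul1r lerDl.
Qed.

(** * Sums over finite subsets and their tails *)

Section FiniteSums.
Local Open Scope fset_scope.
Context {I : choiceType}.

Lemma big_fsetD_incl (M : nmodType) (F : I -> M) (A B : {fset I}) : A `<=` B ->
  (\sum_(i <- B) F i = \sum_(i <- A) F i + \sum_(i <- B `\` A) F i)%R.
Proof.
move=> AB; rewrite (big_fsetID _ (mem A) B); congr (_ + _)%R.
  rewrite (_ : [fset _ | _ in _ & _] = A) //; apply/fsetP => i.
  by rewrite !inE /= andb_idl // => /(fsubsetP AB).
rewrite (_ : [fset _ | _ in _ & _] = B `\` A) //; apply/fsetP => i.
by rewrite !inE /= andbC.
Qed.

Lemma le_fset_sum (R : numDomainType) (a : I -> R) (A B : {fset I}) :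
  (forall i, 0 <= a i)%R -> A `<=` B ->
  (\sum_(i <- A) a i <= \sum_(i <- B) a i)%R.
Proof. by move=> a0 /big_fsetD_incl ->; rewrite lerDl sumr_ge0. Qed.

(** A finite set whose sum is within e of the supremum leaves less than e for the rest of any larger
    set. *)
Lemma bounded_sums_tail (R : realType) (a : I -> R) (M : R) :
  (forall i, 0 <= a i)%R -> (forall A : {fset I}, \sum_(i <- A) a i <= M)%R ->
  forall e : R, (0 < e)%R -> exists A : {fset I}, forall B : {fset I}, A `<=` B ->
    (\sum_(i <- B `\` A) a i < e)%R.
Proof.
move=> a0 aM e e0; pose D : set R := range (fun A : {fset I} => \sum_(i <- A) a i)%R.
have ubD : has_sup D.
  by split; [exists (\sum_(i <- fset0) a i)%R, fset0|exists M => _ [A _ <-]].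
have [_ [A _ <-] Ae] := sup_adherent e0 ubD.
exists A => B AB; have := sup_upper_bound ubD.
have /[swap]/[apply] : D (\sum_(i <- B) a i)%R by exists B.
by rewrite (big_fsetD_incl _ AB); lra.
Qed.

End FiniteSums.

(** * Finite partial sums of the frame sum *)

Section FrameSums.
Context {R : realType} {k : scalars} {H : hilbertType R k} {I : countType}.
Implicit Types (W V : I -> set H) (w : I -> R) (f g : H) (A : {fset I}).

Definition frame_psum W w f A : R :=
  \sum_(i <- A) w i ^+ 2 * hnorm (proj (W i) f) ^+ 2.

Lemma frame_term_ge0 W w f i : 0 <= w i ^+ 2 * hnorm (proj (W i) f) ^+ 2.
Proof. by rewrite mulr_ge0 ?sqr_ge0. Qed.

Lemma frame_sum_ge0 W w f : (0 <= frame_sum W w f)%E.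
Proof. by apply: esum_ge0 => i _; rewrite lee_fin frame_term_ge0. Qed.

Lemma frame_psum_le W w f A : ((frame_psum W w f A)%:E <= frame_sum W w f)%E.
Proof.
apply: esum_ge; exists [set` A]; first by split; [exact: finite_fset|].
by rewrite fsbig_finite ?finite_fset // set_fsetK sumEFin.
Qed.

Lemma frame_sum_le W w f (M : R) :
  (forall A, frame_psum W w f A <= M) -> (frame_sum W w f <= M%:E)%E.
Proof.
move=> AM; apply: ge_ereal_sup => _ [X [Xfin _] <-].
by rewrite fsbig_finite // sumEFin lee_fin; exact: AM.
Qed.

(** Write P for the vector sum. AM-GM splits 2 D <P, P> into D^2 times the partial sum for f plus
    the partial sum for P; the latter is at most D |P|^2 and is absorbed. *)
Lemma synthesis_le W w f (D : R) A : 0 < D ->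
  (forall i, closed_subspace (W i)) ->
  (forall g, (frame_sum W w g <= (D * hnorm g ^+ 2)%:E)%E) ->
  hnorm (\sum_(i <- A) scalar_of k (w i ^+ 2) *: proj (W i) f) ^+ 2
    <= D * frame_psum W w f A.
Proof.
move=> D0 Wc WD; set P := \sum_(i <- A) _.
have PD : frame_psum W w P A <= D * hnorm P ^+ 2.
  by rewrite -lee_fin; exact: le_trans (frame_psum_le _ _ _ _) (WD P).
have : 2 * D * hnorm P ^+ 2 <= D ^+ 2 * frame_psum W w f A + frame_psum W w P A.
  rewrite -rdotff {1}/P rdot_suml /frame_psum !mulr_sumr -big_split /=.
  apply: ler_sum => i _; rewrite rdotZl rdot_proj //.
  have := rdot_le (proj (W i) f) (proj (W i) P).
  set r := rdot _ _; set x := hnorm (proj _ f); set y := hnorm _ => rxy.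
  have w0 := sqr_ge0 (w i).
  have rxy2 : 2 * D * r <= D ^+ 2 * x ^+ 2 + y ^+ 2.
    have := sqr_ge0 (D * x - y); have : D * r <= D * (x * y) by rewrite ler_pM2l.
    lra.
  have := ler_wpM2l w0 rxy2; lra.
move=> h; rewrite -(ler_pM2l D0); lra.
Qed.

End FrameSums.

(** * Convergence, coercivity and inverse of the fusion frame operator *)

Section FusionFrameOperator.
Context {R : realType} {k : scalars} {H : hilbertType R k} {I : countType}.
Variables (W : I -> set H) (w : I -> R) (C D : R).
Hypothesis HW : fusion_frame_with [set: H] W w C D.
Implicit Types (f g : H) (A : {fset I}).

Let C0 : 0 < C. Proof. by case: HW. Qed.
Let D0 : 0 < D. Proof. by case: HW => _ + CD _ => /lt_le_trans; exact. Qed.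
Let Wc i : closed_subspace (W i). Proof. by case: HW => /(_ i)[]. Qed.
Let WC f : ((C * hnorm f ^+ 2)%:E <= frame_sum W w f)%E.
Proof. by case: HW => _ _ _ /(_ f Logic.I)[]. Qed.
Let WD f : (frame_sum W w f <= (D * hnorm f ^+ 2)%:E)%E.
Proof. by case: HW => _ _ _ /(_ f Logic.I)[]. Qed.

Let term f i : H := scalar_of k (w i ^+ 2) *: proj (W i) f.

Lemma partial_sumE (x : I -> H) A :
  summability.partial_sum x A = \sum_(i <- A) x i.
Proof. by rewrite /summability.partial_sum big_seq_fsetE. Qed.

Lemma fusion_frame_operator_cvg f :
  summability.partial_sum (term f) @ summability.totally
    --> fusion_frame_operator W w f.
Proof.
have TF := @summability.totally_filter I.
apply: hnorm_cauchy_cvg => e e0.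
have psumD A : frame_psum W w f A <= D * hnorm f ^+ 2.
  by rewrite -lee_fin; exact: le_trans (frame_psum_le _ _ _ _) (WD f).
(* [synthesis_le] loses a factor D, so tails below e^2 / D give vector tails of norm below e. *)
have eD0 : 0 < e ^+ 2 / D by rewrite divr_gt0 ?exprn_gt0.
have [A AP] := bounded_sums_tail (frame_term_ge0 W w f) psumD eD0.
exists (\sum_(i <- A) term f i); exists A => // B AB /=.
rewrite partial_sumE (big_fsetD_incl _ AB) opprD addrA subrr add0r hnorm_opp.
rewrite -(@ltr_pXn2r _ 2) ?nnegrE ?hnorm_ge0 ?(ltW e0) //.
apply: le_lt_trans (synthesis_le _ _ D0 Wc WD) _.
by rewrite mulrC -ltr_pdivlMr //; exact: AP.
Qed.

(** Each scalar term equals the pairing of the matching vector term with f, and this passes to the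
    limit. *)
Lemma frame_sum_le_operator f :
  (frame_sum W w f <= (rdot (fusion_frame_operator W w f) f)%:E)%E.
Proof.
have TF := @summability.totally_filter I.
set g := fusion_frame_operator W w f.
apply: frame_sum_le => A; apply: (ler_eps (hnorm_ge0 f)) => e e0.
have := cvg_hnorm_lt _ (@fusion_frame_operator_cvg f) e0.
move=> /= [B _ Be].
(* The union contains [A], so its sum dominates that over [A], and contains [B], so its vector sum
   is e-close to g. *)
have := Be (A `|` B)%fset (fsubsetUr _ _); rewrite /= partial_sumE -/g.
set P := \sum_(i <- _) _ => ge.
have AP : frame_psum W w f A <= rdot P f.
  rewrite rdot_suml; apply: le_trans (le_fset_sum (frame_term_ge0 W w f) (fsubsetUl A B)) _.
  by apply: ler_sum => i _; rewrite rdotZl rdot_proj // rdotff.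
have := rdot_le (P - g) f; rewrite rdotDl rdotNl -(hnorm_opp (P - g)) opprB.
have := ler_wpM2r (hnorm_ge0 f) (ltW ge); lra.
Qed.

(** C |f|^2 <= <S f, f> <= |S f| |f|, then divide by |f|. *)
Lemma fusion_frame_operator_ge f :
  C * hnorm f <= hnorm (fusion_frame_operator W w f).
Proof.
have [->|f0] := eqVneq (hnorm f) 0; first by rewrite mulr0 hnorm_ge0.
have {}f0 : 0 < hnorm f by rewrite lt_def f0 hnorm_ge0.
rewrite -(ler_pM2r f0); apply: le_trans (rdot_le _ _).
by rewrite -mulrA -expr2 -lee_fin (le_trans (WC f)) // frame_sum_le_operator.
Qed.

(* Outside the range of the operator the partial inverse takes the value 0. *)
Lemma fusion_frame_operator_inv_le f :
  C * hnorm (fusion_frame_operator_inv W w f) <= hnorm f.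
Proof.
have [fS|fS] := pselect ((fusion_frame_operator W w @` [set: H]) f).
  rewrite -[in leRHS](pinvK (fun=> 0) (mem_set fS)); exact: fusion_frame_operator_ge.
rewrite /fusion_frame_operator_inv /pinv_ splitV oinv_surj.
case: pselect => //= _.
by rewrite -(scale0r 0) -(scalar_of0 (k := k)) hnormZ normr0 mul0r mulr0 hnorm_ge0.
Qed.

End FusionFrameOperator.

(** * Bounds for the woven families, uniform in the index set *)

Section Weaving.
Context {R : realType} {k : scalars} {H : hilbertType R k} {I : countType}.
Variables (W V : I -> set H) (w : I -> R) (C DW DV : R).
Hypothesis HW : fusion_frame_with [set: H] W w C DW.
Hypothesis Vc : forall i, closed_subspace (V i).
Hypothesis HDV : forall f, (frame_sum V w f <= (DV * hnorm f ^+ 2)%:E)%E.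
Hypothesis DV0 : 0 <= DV.
Hypothesis dual : forall f, summability.partial_sum (fun i =>
    scalar_of k (w i * w i) *:
      proj (V i) (fusion_frame_operator_inv W w (proj (W i) f)))
  @ summability.totally --> f.

Let HDW f : (frame_sum W w f <= (DW * hnorm f ^+ 2)%:E)%E.
Proof. by case: HW => _ _ _ /(_ f Logic.I)[]. Qed.
Let C0 : 0 < C. Proof. by case: HW. Qed.
Let D0 : 0 < DW + DV.
Proof. by case: HW => _ _ CD _; rewrite ltr_pwDl // (lt_le_trans C0). Qed.

Lemma woven_upper (s : set I) f :
  (frame_sum (patch V s W) w f <= ((DW + DV) * hnorm f ^+ 2)%:E)%E.
Proof.
rewrite mulrDl EFinD; apply: le_trans (leeD (HDW f) (HDV f)).
rewrite -esumD; try by move=> i _; rewrite lee_fin frame_term_ge0.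
apply: le_esum => i _; rewrite -EFinD lee_fin /patch.
by case: ifP => _; rewrite ?lerDl ?lerDr frame_term_ge0.
Qed.

(* For each index, one of the norms |pi_{W_i} f|, |pi_{V_i} f| enters the
   patched frame sum and the other one the frame sum of W or V, so that the
   terms of the reconstruction of f can be balanced by AM-GM. *)
Lemma woven_lower (s : set I) f :
  ((C ^+ 2 / (DW + DV) * hnorm f ^+ 2)%:E <= frame_sum (patch V s W) w f)%E.
Proof.
have TF := @summability.totally_filter I.
(* This t is the AM-GM weight. It makes the factor 2 t C of |f|^2 equal to 2 (DW + DV), twice what
   the frame sums of [W] and [V] can take up. The remainder gives (DW + DV) |f|^2 <= t^2 E, which is
   the claim after division by t^2. *)
set t := (DW + DV) / C; have t0 : 0 < t by rewrite divr_gt0.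
have tC : t * C = DW + DV by rewrite divfK // gt_eqF.
have Efin : frame_sum (patch V s W) w f \is a fin_num.
  rewrite ge0_fin_numE ?frame_sum_ge0 //.
  by apply: le_lt_trans (woven_upper s f) _; rewrite ltry.
rewrite -(fineK Efin) lee_fin; set E := fine _.
have key : 2 * (DW + DV) * hnorm f ^+ 2 <= t ^+ 2 * E + (DW + DV) * hnorm f ^+ 2.
  have tC20 : 0 <= 2 * (t * C) by rewrite tC; have := D0; lra.
  have tCf0 : 0 <= 2 * (t * C) * hnorm f by rewrite mulr_ge0 ?hnorm_ge0.
  apply: (ler_eps tCf0) => e e0.
  have [A _ /(_ A (fsubset_refl A))] := cvg_hnorm_lt _ (dual (f := f)) e0.
  rewrite /= partial_sumE; set P := \sum_(i <- _) _ => fP.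
  have PE : 2 * (t * C) * rdot P f <= t ^+ 2 * frame_psum (patch V s W) w f A +
      (frame_psum W w f A + frame_psum V w f A).
    rewrite rdot_suml !mulr_sumr -!big_split /=; apply: ler_sum => i _.
    set x := fusion_frame_operator_inv _ _ _; rewrite rdotZl rdot_proj //.
    (* Self-adjointness moves the projection onto [V i] from x to f, where its norm is a frame
       term. *)
    rewrite rdotC -rdot_proj // rdotC -expr2.
    have xf : C * rdot x (proj (V i) f) <= hnorm (proj (W i) f) * hnorm (proj (V i) f).
      apply: le_trans (ler_wpM2r (hnorm_ge0 _) (fusion_frame_operator_inv_le HW _)).
      by rewrite -mulrA ler_pM2l // rdot_le.
    set r := rdot _ _ in xf *.
    have rW : 2 * (t * C) * r <= t ^+ 2 * hnorm (proj (patch V s W i) f) ^+ 2 +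
        (hnorm (proj (W i) f) ^+ 2 + hnorm (proj (V i) f) ^+ 2).
      set a := hnorm (proj (W i) f) in xf *; set b := hnorm (proj (V i) f) in xf *.
      have tr : t * (C * r) <= t * (a * b) by rewrite ler_pM2l.
      have [a2 b2] := (sqr_ge0 a, sqr_ge0 b).
      (* The weight t goes to the norm kept by the patched family; the square of that same norm on
         the right is surplus. *)
      rewrite /patch; case: ifP => _; rewrite -/a -/b.
        by have := sqr_ge0 (t * a - b); lra.
      by have := sqr_ge0 (t * b - a); lra.
    by have := ler_wpM2l (sqr_ge0 (w i)) rW; lra.
  have AE : frame_psum (patch V s W) w f A <= E.
    by rewrite -lee_fin fineK // frame_psum_le.
  have AW : frame_psum W w f A <= DW * hnorm f ^+ 2.
    by rewrite -lee_fin; exact: le_trans (frame_psum_le _ _ _ _) (HDW f).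
  have AV : frame_psum V w f A <= DV * hnorm f ^+ 2.
    by rewrite -lee_fin; exact: le_trans (frame_psum_le _ _ _ _) (HDV f).
  have tAE := ler_wpM2l (sqr_ge0 t) AE.
  have fPf : hnorm f ^+ 2 <= rdot P f + e * hnorm f.
    have := rdot_le (f - P) f; have := ler_wpM2r (hnorm_ge0 f) (ltW fP).
    by rewrite rdotDl rdotNl rdotff; lra.
  have := ler_wpM2l tC20 fPf; move: PE; rewrite tC; lra.
rewrite -(@ler_pM2l _ (t ^+ 2)) ?exprn_gt0 //.
have -> : t ^+ 2 * (C ^+ 2 / (DW + DV) * hnorm f ^+ 2) = (DW + DV) * hnorm f ^+ 2.
  by rewrite /t; field; rewrite !gt_eqF.
move: key; lra.
Qed.

End Weaving.

Theorem corollary2p11 (R : realType) (k : scalars) (H : hilbertType R k)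
    (I : countType) (W V : I -> set H) (w : I -> R)
    (Hsep : separable H)
    (HW : fusion_frame [set: H] W w)
    (HV : dual_fusion_frame V w W w)
    (Hseq : forall s : set I,
       fusion_frame_sequence (patch V s W) (fun=> 1)) :
  woven W w V w.
Proof.
have [C [DW HW']] := HW; have [C0 CD] : 0 < C /\ C <= DW by case: HW'.
have [[Vc [DV HDV]] dual] := HV.
have Wc i : closed_subspace (W i) /\ 0 < w i by case: HW' => /(_ i)[].
(* The definition of a Bessel sequence puts no sign on its bound; the absolute value makes it
   nonnegative. *)
have HDV' f : (frame_sum V w f <= (`|DV| * hnorm f ^+ 2)%:E)%E.
  by apply: le_trans (HDV f) _; rewrite lee_fin ler_wpM2r ?sqr_ge0 ?ler_norm.
have D0 : 0 < DW + `|DV| by rewrite ltr_pwDl // (lt_le_trans C0).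
set c := C ^+ 2 / (DW + `|DV|); set D := DW + `|DV| in c D0 *.
(* The minimum makes the required order of the two bounds immediate. *)
have woven_with s : fusion_frame_with [set: H] (patch V s W) (patch w s w)
    (Num.min c D) D.
  have -> : patch w s w = w by apply/funext => i; rewrite /patch; case: ifP.
  split=> [i|||f _].
  - split=> //; last by case: (Wc i).
    by rewrite /patch; case: ifP => _; [case: (Wc i)|case: (Vc i)].
  - by rewrite lt_min D0 andbT divr_gt0 ?exprn_gt0.
  - by rewrite ge_min lexx orbT.
  - split; last exact: (woven_upper HW' HDV').
    apply: le_trans (woven_lower HW' (fun i => (Vc i).1) HDV' (normr_ge0 _) dual s f).
    by rewrite lee_fin ler_wpM2r ?sqr_ge0 // ge_min lexx.
split=> //; last by exists (Num.min c D), D.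
(* The family [V] is the weaving for the empty index set, so it inherits the universal bounds. *)
exists (Num.min c D), D; have := woven_with set0.
rewrite (_ : patch V set0 W = V) 1?(_ : patch w set0 w = w) //;
  by apply/funext => i; rewrite /patch in_set0.
Qed.
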